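(* Let $n\ge 1$ and let $\Gamma_n=(\Gamma_n,\alpha_n,\nabla_n)$ be the $(2n,n+1)$-type GKM graph of the Grassmannian $G_2(\mathbb{C}^{n+2})$ with its standard effective $T^{n+1}$-action. Then the group of axial functions $\mathcal{A}(\Gamma_{n})$ is isomorphic to $\mathbb{Z}^{n+1}$.
   Context: The GKM graph $(\Gamma_n,\alpha_n,\nabla_n)$. Let $[n+2]=\{1,\dots,n+2\}$. The vertices of $\Gamma_n$ are the 2-element subsets $\{i,j\}\subset[n+2]$; two distinct vertices are joined by exactly one edge if they intersect, and are not joined otherwise. For distinct $i,j,k$, $E_{i,j}^{i,k}$ denotes the oriented edge from $\{i,j\}$ to $\{i,k\}$ (indices within a pair are unordered); its reverse is $\overline{E_{i,j}^{i,k}}=E_{i,k}^{i,j}$. $\Gamma_n$ is $2n$-valent. Let $a_1,\dots,a_{n+1}$ be the standard basis of $H^2(BT^{n+1})\simeq\mathbb{Z}^{n+1}$ and $a_{n+2}=0$. The axial function is $\alpha_n(E_{i,j}^{i,k})=-a_j+a_k$. The connection $\nabla_n$ consists of the bijections $(\nabla_n)_{i,j}^{i,k}$ from the out-going edges at $\{i,j\}$ to those at $\{i,k\}$ (one for each edge $E_{i,j}^{i,k}$) given by $E_{i,j}^{i,k}\mapsto E_{i,k}^{i,j}$, $E_{i,j}^{j,k}\mapsto E_{i,k}^{j,k}$, and, for $l\in[n+2]\setminus\{i,j,k\}$, $E_{i,j}^{i,l}\mapsto E_{i,k}^{i,l}$, $E_{i,j}^{j,l}\mapsto E_{i,k}^{k,l}$.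 Group of axial functions. For a graph $\Gamma$ with oriented edges $E(\Gamma)$, let $i(e),t(e)$ be initial and terminal vertices, $\overline{e}$ the reversed edge, $E_p(\Gamma)=\{e:i(e)=p\}$. For a GKM graph $(\Gamma,\alpha,\nabla)$ the congruence coefficients are the integers $c_e(e')$ ($e'\in E_{i(e)}(\Gamma)$) with $\alpha(\nabla_e(e'))-\alpha(e')=c_e(e')\alpha(e)$. Let $\mathbb{Z}E_p(\Gamma)$ be the free abelian group with basis $E_p(\Gamma)$; $x_e$ is the coefficient of $e$ in $x\in\mathbb{Z}E_p(\Gamma)$. Let $N_e:\mathbb{Z}E_{i(e)}(\Gamma)\to\mathbb{Z}E_{t(e)}(\Gamma)$ be the isomorphism sending $e'$ to $\nabla_e(e')$, and $c_{(\Gamma,\alpha,\nabla)}(e)=\sum_{e'\in E_{i(e)}(\Gamma)}c_e(e')\,e'$. Then $\mathcal{A}(\Gamma,\alpha,\nabla)$ is the group of all $f=(f(p))_p\in\bigoplus_{p\in V(\Gamma)}\mathbb{Z}E_p(\Gamma)$ such that for every $e\in E(\Gamma)$, with $p=i(e)$, $q=t(e)$: $N_e(f(p))-f(q)=f(q)_{\overline{e}}\,c_{(\Gamma,\alpha,\nabla)}(\overline{e})$. Write $\mathcal{A}(\Gamma_n)=\mathcal{A}(\Gamma_n,\alpha_n,\nabla_n)$. *)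

(* Defs.v *)
From HB Require Import structures.
From mathcomp Require Import all_boot all_order all_fingroup all_algebra.

Set Implicit Arguments.
Unset Strict Implicit.
Unset Printing Implicit Defensive.

Import GRing.Theory.
Local Open Scope ring_scope.

(* A GKM graph of type (m, r): m-valent, with labels in H^2(BT^r) = Z^r.      *)
(* Edges are oriented, the terminal vertex of e is the initial vertex of its  *)
(* reverse, and E_p is the subtype {e | i(e) = p}.  The connection along e is *)
(* a map E_{i(e)} -> E_{t(e)}; its bijectivity follows from gkm_nablaK.       *)
(* gkm_alpha_neq0 only adds to pairwise independence at 1-valent vertices; it *)
(* makes the congruence coefficients unique.                                  *)
Record gkm_graph (m r : nat) := GKMGraph {
  gkm_vert : finType;
  gkm_edge : finType;
  gkm_ini : gkm_edge -> gkm_vert;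
  gkm_rev : gkm_edge -> gkm_edge;
  gkm_alpha : gkm_edge -> 'rV[int]_r;
  gkm_nabla : forall e : gkm_edge,
    {e' : gkm_edge | gkm_ini e' == gkm_ini e} ->
    {e' : gkm_edge | gkm_ini e' == gkm_ini (gkm_rev e)};
  gkm_revK : involutive gkm_rev;
  gkm_rev_neq : forall e, gkm_rev e != e;
  gkm_valence : forall p, #|[set e | gkm_ini e == p]| = m;
  gkm_alpha_rev : forall e,
    gkm_alpha (gkm_rev e) = gkm_alpha e \/
    gkm_alpha (gkm_rev e) = - gkm_alpha e;
  gkm_alpha_neq0 : forall e, gkm_alpha e != 0;
  gkm_alpha_indep : forall e e', gkm_ini e = gkm_ini e' -> e != e' ->
    forall a b : int, gkm_alpha e *~ a + gkm_alpha e' *~ b = 0 ->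
    a = 0 /\ b = 0;
  gkm_effective : forall p (v : 'rV[int]_r), exists a : gkm_edge -> int,
    v = \sum_(e | gkm_ini e == p) gkm_alpha e *~ a e;
  gkm_nablaK : forall e x,
    val (@gkm_nabla (gkm_rev e) (@gkm_nabla e x)) = val x;
  gkm_nabla_self : forall e x, val x = e -> val (@gkm_nabla e x) = gkm_rev e;
  gkm_congruence : forall e x, exists c : int,
    gkm_alpha (val (@gkm_nabla e x)) - gkm_alpha (val x) == gkm_alpha e *~ c
}.

Section AxialGroup.
Variables (m r : nat) (G : gkm_graph m r).

Definition gkm_ter (e : gkm_edge G) : gkm_vert G := gkm_ini (gkm_rev e).

Definition star (p : gkm_vert G) : Type := {e : gkm_edge G | gkm_ini e == p}.

HB.instance Definition _ p := Finite.on (star p).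

Definition edge_star (e : gkm_edge G) : star (gkm_ini e) :=
  exist _ e (eqxx (gkm_ini e)).

Definition rev_star (e : gkm_edge G) : star (gkm_ter e) :=
  edge_star (gkm_rev e).

Definition conn (e : gkm_edge G) : star (gkm_ini e) -> star (gkm_ter e) :=
  @gkm_nabla m r G e.

Definition congr_coef (e : gkm_edge G) (e' : star (gkm_ini e)) : int :=
  xchoose (gkm_congruence e').

Lemma congr_coefP (e : gkm_edge G) (e' : star (gkm_ini e)) :
  gkm_alpha (val (conn e')) - gkm_alpha (val e') =
  gkm_alpha e *~ congr_coef e'.
Proof. exact/eqP/(xchooseP (gkm_congruence e')). Qed.

Definition ZE (p : gkm_vert G) : Type := {ffun star p -> int}.

HB.instance Definition _ p := GRing.Zmodule.on (ZE p).

Definition ZE_basis (p : gkm_vert G) (e : star p) : ZE p :=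
  [ffun e' : star p => (e' == e)%:R : int].

Definition transport (e : gkm_edge G) (x : ZE (gkm_ini e)) : ZE (gkm_ter e) :=
  \sum_(e' : star (gkm_ini e)) ZE_basis (conn e') *~ x e'.

Definition congr_vec (e : gkm_edge G) : ZE (gkm_ini e) :=
  \sum_(e' : star (gkm_ini e)) ZE_basis e' *~ congr_coef e'.

(* The finite direct sum of the ZE p, as a dependent product. *)
Definition sumZE : Type := {dffun forall p : gkm_vert G, ZE p}.

HB.instance Definition _ := Choice.on sumZE.

Definition sumZE_zero : sumZE := [ffun p => 0 : ZE p].
Definition sumZE_opp (f : sumZE) : sumZE := [ffun p => - f p : ZE p].
Definition sumZE_add (f g : sumZE) : sumZE := [ffun p => f p + g p : ZE p].

Lemma sumZE_addA : associative sumZE_add.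
Proof. by move=> f g h; apply/ffunP=> p; rewrite !ffunE addrA. Qed.

Lemma sumZE_addC : commutative sumZE_add.
Proof. by move=> f g; apply/ffunP=> p; rewrite !ffunE addrC. Qed.

Lemma sumZE_add0 : left_id sumZE_zero sumZE_add.
Proof. by move=> f; apply/ffunP=> p; rewrite !ffunE add0r. Qed.

Lemma sumZE_addN : left_inverse sumZE_zero sumZE_opp sumZE_add.
Proof. by move=> f; apply/ffunP=> p; rewrite !ffunE addNr. Qed.

HB.instance Definition _ := GRing.isZmodule.Build sumZE
  sumZE_addA sumZE_addC sumZE_add0 sumZE_addN.

Definition axial_pred : {pred sumZE} := fun f =>
  [forall e : gkm_edge G,
    transport (f (gkm_ini e)) - f (gkm_ter e) ==
      congr_vec (gkm_rev e) *~ (f (gkm_ter e) (rev_star e)) :> ZE (gkm_ter e)].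

Lemma transportB e (x y : ZE (gkm_ini e)) :
  transport (x - y) = transport x - transport y.
Proof.
rewrite /transport -sumrB; apply: eq_bigr => e' _.
by rewrite !ffunE mulrzBr.
Qed.

Lemma axial_zmod_closed : zmod_closed axial_pred.
Proof.
split.
  apply/forallP=> e; rewrite !ffunE mulr0z subr0 /transport big1 // => e' _.
  by rewrite ffunE mulr0z.
move=> f g /forallP Hf /forallP Hg; apply/forallP=> e.
have E p : (f - g) p = f p - g p by rewrite !ffunE.
rewrite !E transportB !ffunE mulrzBr -(eqP (Hf e)) -(eqP (Hg e)).
by rewrite !opprB addrACA [- _ + _]addrC addrACA !addrA.
Qed.

HB.instance Definition _ :=
  GRing.isZmodClosed.Build sumZE axial_pred axial_zmod_closed.

Record axial_group := AxialGroup {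
  axial_val :> sumZE;
  axial_valP : axial_val \in axial_pred
}.

HB.instance Definition _ := [isSub for axial_val].
HB.instance Definition _ := [Choice of axial_group by <:].
HB.instance Definition _ := [SubChoice_isSubZmodule of axial_group by <:].

End AxialGroup.

Section Grassmannian.
Variable n : nat.

(* The index set [n+2], shifted to {0, ..., n+1}. *)
Local Notation I := 'I_n.+2.

Definition gr_vert : Type := {p : {set I} | #|p| == 2%N}.

HB.instance Definition _ := Finite.on gr_vert.

(* The triple (i, j, k) is the oriented edge from {i, j} to {i, k}. *)
Definition gr_edge : Type :=
  {t : I * I * I | [&& t.1.1 != t.1.2, t.1.1 != t.2 & t.1.2 != t.2]}.

HB.instance Definition _ := Finite.on gr_edge.

Definition gr_E (i j k : I) (ij : i != j) (ik : i != k) (jk : j != k) :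
    gr_edge :=
  exist (fun t : I * I * I =>
      [&& t.1.1 != t.1.2, t.1.1 != t.2 & t.1.2 != t.2])
    (i, j, k) (introT and3P (And3 ij ik jk)).

Definition gr_pair (i j : I) (ij : i != j) : gr_vert :=
  exist (fun p : {set I} => #|p| == 2%N) [set i; j]
    (etrans (congr1 (eq_op^~ 2%N) (cards2 i j))
            (congr1 (fun b : bool => b.+1 == 2%N) ij)).

Lemma gr_edgeP (e : gr_edge) :
  [/\ (val e).1.1 != (val e).1.2, (val e).1.1 != (val e).2 &
      (val e).1.2 != (val e).2].
Proof. exact/and3P/(valP e). Qed.

Definition gr_ini (e : gr_edge) : gr_vert :=
  let: And3 ij _ _ := gr_edgeP e in gr_pair ij.

Definition gr_rev (e : gr_edge) : gr_edge :=
  let: And3 ij ik jk := gr_edgeP e in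
  gr_E ik ij (etrans (congr1 negb (eq_sym _ _)) jk).

Lemma val_gr_ini e : val (gr_ini e) = [set (val e).1.1; (val e).1.2].
Proof. by rewrite /gr_ini; case: (gr_edgeP e). Qed.

Lemma val_gr_rev e :
  val (gr_rev e) = ((val e).1.1, (val e).2, (val e).1.2).
Proof. by rewrite /gr_rev; case: (gr_edgeP e). Qed.

Lemma gr_iniP e e' : gr_ini e = gr_ini e' <->
  ((val e).1.1 = (val e').1.1 /\ (val e).1.2 = (val e').1.2) \/
  ((val e).1.1 = (val e').1.2 /\ (val e).1.2 = (val e').1.1).
Proof.
have [ij _ _] := gr_edgeP e; have [ij' _ _] := gr_edgeP e'.
split=> [/(congr1 val)|H]; last first.
  by apply/val_inj; rewrite !val_gr_ini; case: H => -[-> ->] //; rewrite setUC.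
rewrite !val_gr_ini => /setP Eq.
move: (Eq (val e).1.1) (Eq (val e).1.2) ij ij'.
rewrite !inE !eqxx orbT /= => /esym/orP[]/eqP-> /esym/orP[]/eqP->;
  rewrite ?eqxx //; by auto.
Qed.

Lemma gr_adjacent (p q : gr_vert) : p != q ->
  (exists e, gr_ini e = p /\ gr_ini (gr_rev e) = q) <->
  val p :&: val q != set0.
Proof.
move=> pq; split=> [[e [<- <-]]|/set0Pn[i /setIP[ip iq]]].
  apply/set0Pn; exists (val e).1.1.
  by rewrite !val_gr_ini val_gr_rev !inE !eqxx.
have other (r : gr_vert) : i \in val r ->
    exists2 j, i != j & val r = [set i; j].
  move=> ir; have /cards2P[a [b [ab E]]] := valP r.
  move: ir; rewrite E !inE => /orP[]/eqP ->; first by exists b.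
  by exists a; [rewrite eq_sym | rewrite setUC].
have [j ij Ep] := other p ip; have [k ik Eq] := other q iq.
have jk : j != k.
  by apply: contraNneq pq => jk; apply/eqP/val_inj; rewrite Ep Eq jk.
exists (gr_E ij ik jk); split; apply/val_inj.
  by rewrite val_gr_ini /= Ep.
by rewrite val_gr_ini val_gr_rev /= Eq.
Qed.

Lemma gr_simple (e e' : gr_edge) : gr_ini e = gr_ini e' ->
  gr_ini (gr_rev e) = gr_ini (gr_rev e') -> e = e'.
Proof.
have [] := gr_edgeP e; have [] := gr_edgeP e'.
move=> a1 a2 a3 b1 b2 b3 /gr_iniP H /gr_iniP; rewrite !val_gr_rev.
move=> H'; apply: val_inj; move: a1 a2 a3 b1 b2 b3 H H'.
case: (val e) (val e') => [[i j] k] [[x y] z] /=.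
move=> a1 a2 a3 b1 b2 b3 H H'.
case: H => -[? ?]; case: H' => -[? ?]; subst => //;
  by move: a1 a2 a3 b1 b2 b3; rewrite ?eqxx.
Qed.

(* a_1, ..., a_(n+1) is the standard basis, and the row a_(n+2) is zero since *)
(* its index n+1 (counted from 0) is not a column index.                      *)
Definition gr_a (i : I) : 'rV[int]_n.+1 :=
  \row_(j < n.+1) (nat_of_ord i == nat_of_ord j)%:R.

Definition gr_alpha (e : gr_edge) : 'rV[int]_n.+1 :=
  - gr_a (val e).1.2 + gr_a (val e).2.

(* The four cases of the connection along (i, j, k) on an edge t out of       *)
(* {i, j}; in the last two t.2 is the index l outside {i, j, k}.              *)
Definition gr_nabla_triple (i j k : I) (t : I * I * I) : I * I * I :=
  if t == (i, j, k) then (i, k, j)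
  else if t == (j, i, k) then (k, i, j)
  else if t.1.1 == i then (i, k, t.2)
  else (k, i, t.2).

Lemma gr_nabla_tripleE (e e' : gr_edge) : gr_ini e' = gr_ini e ->
  gr_nabla_triple (val e).1.1 (val e).1.2 (val e).2 (val e') =
  (tperm (val e).1.2 (val e).2 (val e').1.1,
   tperm (val e).1.2 (val e).2 (val e').1.2,
   tperm (val e).1.2 (val e).2 (val e').2).
Proof.
have [] := gr_edgeP e; have [] := gr_edgeP e'; rewrite /gr_nabla_triple.
move=> + + + + + + /gr_iniP.
case: (val e) (val e') => [[i j] k] [[x y] z] /=.
move=> a1 a2 a3 b1 b2 b3 [] [? ?]; subst.
  rewrite !xpair_eqE !eqxx (negbTE b1) /= [tperm _ _ i]tpermD 1?eq_sym //.
  rewrite tpermL; have [->|zk] := eqVneq z k; first by rewrite tpermR.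
  by rewrite tpermD // eq_sym.
rewrite !xpair_eqE !eqxx [j == i]eq_sym (negbTE b1) /=.
rewrite [tperm _ _ i]tpermD 1?eq_sym // tpermL.
have [->|zk] := eqVneq z k; first by rewrite tpermR.
by rewrite tpermD // eq_sym.
Qed.

Lemma gr_nabla_subproof (e : gr_edge) (e' : {e' | gr_ini e' == gr_ini e}) :
  let t := gr_nabla_triple (val e).1.1 (val e).1.2 (val e).2 (val (val e')) in
  [&& t.1.1 != t.1.2, t.1.1 != t.2 & t.1.2 != t.2].
Proof.
rewrite gr_nabla_tripleE; last exact/eqP/(valP e').
rewrite /= !(inj_eq perm_inj); exact: (valP (val e')).
Qed.

Definition gr_nabla_edge (e : gr_edge) (e' : {e' | gr_ini e' == gr_ini e}) :
    gr_edge :=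
  exist (fun t : I * I * I =>
      [&& t.1.1 != t.1.2, t.1.1 != t.2 & t.1.2 != t.2])
    _ (gr_nabla_subproof e').

Lemma gr_nabla_star (e : gr_edge) (e' : {e' | gr_ini e' == gr_ini e}) :
  gr_ini (gr_nabla_edge e') == gr_ini (gr_rev e).
Proof.
have Ei := eqP (valP e'); apply/eqP/gr_iniP; rewrite val_gr_rev /=.
rewrite gr_nabla_tripleE //=; have [ij ik jk] := gr_edgeP e.
have /gr_iniP[] := Ei => -[-> ->]; rewrite tpermL tpermD 1?eq_sym //; by auto.
Qed.

Definition gr_nabla (e : gr_edge) (e' : {e' | gr_ini e' == gr_ini e}) :
    {e' | gr_ini e' == gr_ini (gr_rev e)} :=
  exist _ (gr_nabla_edge e') (gr_nabla_star e').

Lemma val_gr_nabla e e' : val (val (@gr_nabla e e')) =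
  (tperm (val e).1.2 (val e).2 (val (val e')).1.1,
   tperm (val e).1.2 (val e).2 (val (val e')).1.2,
   tperm (val e).1.2 (val e).2 (val (val e')).2).
Proof. by rewrite /= gr_nabla_tripleE //; apply/eqP/(valP e'). Qed.

Lemma gr_revK : involutive gr_rev.
Proof.
move=> e; apply: val_inj; rewrite !val_gr_rev /=.
by case: (val e) => -[].
Qed.

Lemma gr_rev_neq e : gr_rev e != e.
Proof.
have [_ _ jk] := gr_edgeP e; apply: contraNneq jk => /(congr1 val).
by rewrite val_gr_rev; case: (val e) => -[i j k] /= [->].
Qed.

Lemma gr_valence p : #|[set e | gr_ini e == p]| = (2 * n)%N.
Proof.
pose h (e : gr_edge) := ((val e).1.1, (val e).2).
have h_inj : {in [set e | gr_ini e == p] &, injective h}.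
  move=> e e'; rewrite !inE => /eqP Ep /eqP Ep' [h1 h2].
  have [ij _ _] := gr_edgeP e; have [ij' _ _] := gr_edgeP e'.
  have /gr_iniP H : gr_ini e = gr_ini e' by rewrite Ep Ep'.
  have {}h1 : (val e).1.1 = (val e').1.1 := h1.
  have {}h2 : (val e).2 = (val e').2 := h2.
  apply: val_inj; move: h1 h2 ij ij' H.
  case: (val e) (val e') => [[i j] k] [[x y] z] /= -> -> ij ij'.
  by case=> -[E1 E2]; subst => //; move: ij'; rewrite eqxx.
rewrite -(card_in_imset h_inj).
have -> : h @: [set e | gr_ini e == p] = setX (val p) (~: val p).
  apply/setP=> -[x z]; rewrite !inE /=; apply/imsetP/andP.
    move=> [e]; rewrite inE => /eqP<- [-> ->].
    have [ij ik jk] := gr_edgeP e.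
    rewrite !val_gr_ini !inE negb_or; split; first by rewrite eqxx.
    by apply/andP; split; rewrite eq_sym.
  move=> [xp' zp']; have /cards2P[a [b [ab E]]] := valP p.
  have xp : x \in val p := xp'; have zp : z \notin val p := zp'.
  have [y xy Ep] : exists2 y, x != y & val p = [set x; y].
    move: xp; rewrite E !inE => /orP[]/eqP ->; first by exists b.
    by exists a; [rewrite eq_sym | rewrite setUC].
  move: zp; rewrite Ep !inE negb_or => /andP[zx zy].
  have xz : x != z by rewrite eq_sym.
  have yz : y != z by rewrite eq_sym.
  exists (gr_E xy xz yz) => //; rewrite inE; apply/eqP/val_inj.
  by rewrite val_gr_ini Ep.
rewrite cardsX; have /eqP p2 : #|val p| == 2%N := valP p.
have := cardsC (val p); rewrite p2 card_ord !add2n => /eqP.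
by rewrite !eqSS => /eqP ->.
Qed.

Lemma gr_alpha_rev e : gr_alpha (gr_rev e) = - gr_alpha e.
Proof. by rewrite /gr_alpha val_gr_rev /= opprD opprK addrC. Qed.

(* Lift of a vector of Z^(n+1) to the vector of Z^(n+2) with entry sum 0. *)
Definition gr_lift (v : 'rV[int]_n.+1) (m : I) : int :=
  if unlift ord_max m is Some m' then v 0 m' else - \sum_j v 0 j.

Lemma gr_liftD u v m : gr_lift (u + v) m = gr_lift u m + gr_lift v m.
Proof.
rewrite /gr_lift; case: unlift => [m'|]; first by rewrite mxE.
by rewrite -opprD -big_split; congr (- _); apply: eq_bigr => j _; rewrite mxE.
Qed.

Lemma gr_lift0 m : gr_lift 0 m = 0.
Proof.
rewrite /gr_lift; case: unlift => [m'|]; first by rewrite mxE.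
by rewrite big1 ?oppr0 // => j _; rewrite mxE.
Qed.

Lemma gr_liftN u m : gr_lift (- u) m = - gr_lift u m.
Proof. by apply/eqP; rewrite -addr_eq0 -gr_liftD addNr gr_lift0. Qed.

Lemma gr_liftMn u a m : gr_lift (u *+ a) m = gr_lift u m *+ a.
Proof.
by elim: a => [|a IH]; rewrite ?mulr0n ?gr_lift0 // !mulrS gr_liftD IH.
Qed.

Lemma gr_liftMz u a m : gr_lift (u *~ a) m = gr_lift u m * a.
Proof.
rewrite -mulrzz; case: a => a; rewrite ?NegzE ?mulrNz ?gr_liftN;
  by rewrite -!pmulrn gr_liftMn.
Qed.

Lemma gr_lift_a i m :
  gr_lift (gr_a i) m = (m == i)%:R - (m == ord_max)%:R.
Proof.
rewrite /gr_lift; case: unliftP => [m' ->|->].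
  rewrite mxE [lift _ _ == ord_max]eq_sym (negbTE (neq_lift _ _)) subr0.
  congr (_%:R); rewrite eq_sym -val_eqE /= /bump.
  by rewrite leqNgt ltn_ord add0n.
rewrite eqxx; case: (unliftP ord_max i) => [i' ->|->].
  rewrite (negbTE (neq_lift _ _)) (bigD1 i') //= big1 => [|j ji].
    by rewrite mxE /= /bump leqNgt ltn_ord add0n eqxx addr0 sub0r.
  rewrite mxE /= /bump leqNgt ltn_ord add0n.
  by rewrite val_eqE eq_sym (negbTE ji).
rewrite eqxx subrr big1 ?oppr0 // => j _.
by rewrite mxE /= gtn_eqF.
Qed.

Lemma gr_lift_alpha e m :
  gr_lift (gr_alpha e) m = (m == (val e).2)%:R - (m == (val e).1.2)%:R.
Proof.
by rewrite /gr_alpha gr_liftD gr_liftN !gr_lift_a opprB addrC addrA subrK.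
Qed.

Lemma gr_alpha_neq0 e : gr_alpha e != 0.
Proof.
have [_ _ jk] := gr_edgeP e.
apply/eqP => /(congr1 (gr_lift^~ (val e).2)).
by rewrite gr_lift_alpha gr_lift0 eqxx eq_sym (negbTE jk) subr0.
Qed.

Lemma gr_alpha_indep e e' : gr_ini e = gr_ini e' -> e != e' ->
  forall a b : int, gr_alpha e *~ a + gr_alpha e' *~ b = 0 -> a = 0 /\ b = 0.
Proof.
move=> /gr_iniP Ei ne a b Eq.
have L m : ((m == (val e).2)%:R - (m == (val e).1.2)%:R) * a +
           ((m == (val e').2)%:R - (m == (val e').1.2)%:R) * b = 0 :> int.
  by rewrite -!gr_lift_alpha -!gr_liftMz -gr_liftD Eq gr_lift0.
have [] := gr_edgeP e; have [] := gr_edgeP e'.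
rewrite -(inj_eq val_inj) in ne; move: Ei ne L {Eq}.
case: (val e) (val e') => [[i j] k] [[x y] z] /=.
case=> -[-> ->] ne L a1 a2 a3 b1 b2 b3.
  have kz : k != z by apply: contraNneq ne => ->.
  have := L k; have := L z.
  rewrite !eqxx (negbTE kz) [z == k]eq_sym (negbTE kz) [z == y]eq_sym.
  rewrite [k == y]eq_sym (negbTE a3) (negbTE b3).
  by rewrite !subr0 !mul0r !mul1r !addr0 !add0r.
have := L x; have := L y.
rewrite !eqxx (negbTE a1) [y == x]eq_sym (negbTE a1) (negbTE a2) (negbTE a3).
rewrite (negbTE b3) (negbTE b2) /= ?mulr0n ?mulr1n !subrr !sub0r.
by rewrite !mul0r !addr0 !add0r !mulN1r => /eqP + /eqP; rewrite !oppr_eq0 => /eqP-> /eqP->.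
Qed.

Hypothesis n_gt0 : (0 < n)%N.

Lemma gr_effective p (v : 'rV[int]_n.+1) : exists a : gr_edge -> int,
  v = \sum_(e | gr_ini e == p) gr_alpha e *~ a e.
Proof.
pose S (w : 'rV[int]_n.+1) := exists a : gr_edge -> int,
  w = \sum_(e | gr_ini e == p) gr_alpha e *~ a e.
have S0 : S 0 by exists (fun=> 0); rewrite big1.
have SB w w' : S w -> S w' -> S (w - w').
  move=> [a ->] [b ->]; exists (fun e => a e - b e).
  by rewrite -sumrB; apply: eq_bigr => e _; rewrite mulrzBr.
have SD w w' : S w -> S w' -> S (w + w').
  by move=> Sw Sw'; rewrite -[w']opprK -[- w']sub0r; apply/SB/SB.
have SE e : gr_ini e = p -> S (gr_alpha e).
  move=> Ee; exists (fun e' => (e' == e)%:R).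
  rewrite (bigD1 e) ?Ee //= eqxx big1 ?addr0 // => e' /andP[_ /negbTE->].
  by rewrite mulr0z.
have /cards2P[x [y [xy Ep]]] := valP p.
have SE' i j k : i != j -> val p = [set i; j] -> k \notin val p ->
    S (gr_a k - gr_a j).
  move=> ij Ep'; rewrite Ep' !inE negb_or => /andP[ki kj].
  have ik : i != k by rewrite eq_sym.
  have jk : j != k by rewrite eq_sym.
  rewrite addrC; apply: (SE (gr_E ij ik jk)); apply: val_inj.
  by rewrite val_gr_ini Ep'.
have yx : y != x by rewrite eq_sym.
have Ep' : val p = [set y; x] by rewrite Ep setUC.
have [k kp] : exists k, k \notin val p.
  apply/existsP; rewrite -negb_forall; apply/negP => /forallP allp.
  have /eqP := valP p; have -> : val p = setT.
    by apply/setP=> i; rewrite (allp i) inE.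
  by rewrite cardsT card_ord => -[]; move: n_gt0; case: (n).
have Sx z : S (gr_a z - gr_a x).
  have [zp|zp] := boolP (z \in val p); last exact: SE' yx Ep' zp.
  move: zp; rewrite Ep !inE => /orP[]/eqP->; first by rewrite subrr.
  rewrite -[gr_a y](subKr (gr_a k)) addrAC.
  exact: SB (SE' _ _ _ yx Ep' kp) (SE' _ _ _ xy Ep kp).
have Sa z : S (gr_a z).
  have a0 : gr_a ord_max = 0.
    by apply/rowP=> j; rewrite !mxE /= gtn_eqF.
  have := SB _ _ (Sx z) (Sx ord_max).
  by rewrite a0 sub0r opprK subrK.
have SMn w a : S w -> S (w *+ a).
  by move=> Sw; elim: a => [|a IH]; rewrite ?mulr0n // mulrS; apply: SD.
have SMz w a : S w -> S (w *~ a).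
  move=> Sw; case: a => a; first exact: SMn.
  by rewrite NegzE mulrNz -[- _]sub0r; apply/SB/SMn.
rewrite -/(S v) (row_sum_delta v); apply: big_ind => // j _.
have -> : v 0 j *: delta_mx 0 j = gr_a (lift ord_max j) *~ v 0 j.
  rewrite -scaler_int intz; congr (_ *: _); apply/rowP=> i; rewrite !mxE /=.
  by rewrite /bump leqNgt ltn_ord add0n eq_sym val_eqE.
exact: SMz.
Qed.

Lemma gr_nablaK e x : val (@gr_nabla (gr_rev e) (@gr_nabla e x)) = val x.
Proof.
apply: val_inj; rewrite !val_gr_nabla val_gr_rev /=.
rewrite ![tperm (sval e).2 _]tpermC !tpermK.
by case: (sval (sval x)) => -[].
Qed.

Lemma gr_nabla_self e x : val x = e -> val (@gr_nabla e x) = gr_rev e.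
Proof.
move=> Ex; apply: val_inj; rewrite val_gr_nabla Ex val_gr_rev tpermL tpermR.
by have [ij ik _] := gr_edgeP e; rewrite tpermD // eq_sym.
Qed.

Lemma gr_congruence e x : exists c : int,
  gr_alpha (val (@gr_nabla e x)) - gr_alpha (val x) == gr_alpha e *~ c.
Proof.
pose b (i j : I) : int := (i == j)%:R.
have A i j k :
    gr_a (tperm j k i) = gr_a i + (gr_a k - gr_a j) *~ (b i j - b i k).
  rewrite /b; have [->|ij] := eqVneq i j.
    have [->|jk] := eqVneq j k; first by rewrite tperm1 perm1 subrr mul0rz addr0.
    by rewrite tpermL subr0 mulr1z addrC subrK.
  have [->|ik] := eqVneq i k.
    by rewrite tpermR sub0r mulrNz mulr1z opprB addrC subrK.
  by rewrite tpermD 1?eq_sym // subrr mulr0z addr0.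
pose d i := b i (val e).1.2 - b i (val e).2.
exists (d (val (val x)).2 - d (val (val x)).1.2); apply/eqP.
rewrite /gr_alpha val_gr_nabla /= !A -/(d _) -/(d _).
have Z (p q u v : 'rV[int]_n.+1) : - (p + u) + (q + v) - (- p + q) = v - u.
  rewrite [- (p + u)]opprD [X in X - _]addrACA.
  by apply/eqP; rewrite subr_eq [- u + v]addrC [eqbRHS]addrC.
by rewrite Z -mulrzBr [- _ + gr_a (sval e).2]addrC.
Qed.

Definition grassmannian_gkm : gkm_graph (2 * n) n.+1 :=
  @GKMGraph _ _ gr_vert gr_edge gr_ini gr_rev gr_alpha gr_nabla
    gr_revK gr_rev_neq gr_valence (fun e => or_intror (gr_alpha_rev e))
    gr_alpha_neq0 gr_alpha_indep gr_effective gr_nablaK gr_nabla_self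
    gr_congruence.

End Grassmannian.

(* Main.v *)
(** Every linear functional l on the labels of a GKM graph gives the axial
    function whose coefficient at an edge e is l(alpha(e)).  For Gamma_n every
    axial function arises in this way: writing F(i,j,k) for its coefficient at
    the edge from {i,j} to {i,k}, the axial equations say that F is
    antisymmetric in j and k, does not depend on i, and satisfies
    F(i,j,k) = F(j,i,k) - F(k,i,j); hence F(i,j,k) = u_k - u_j with
    u_z = F(_, n+2, z), and u_(n+2) = 0 leaves n+1 free parameters. *)

Require Import Defs.
From HB Require Import structures.
From mathcomp Require Import all_boot all_order all_fingroup all_algebra.

Set Implicit Arguments.
Unset Strict Implicit.
Unset Printing Implicit Defensive.

Import GRing.Theory.
Local Open Scope ring_scope.

Lemma mulrIz_row (r : nat) (v : 'rV[int]_r) : v != 0 -> injective ( *~%R v).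
Proof.
move=> /rV0Pn[j vj] a b /rowP/(_ j).
by rewrite -!scaler_int !mxE !intz => /(mulIf vj).
Qed.

(** * Axial functions on an arbitrary GKM graph *)

Section AxialFunctions.
Variables (m r : nat) (G : gkm_graph m r).
Implicit Types (e : gkm_edge G) (f : sumZE G).

Definition axial_coef f e : int := f (gkm_ini e) (edge_star e).

Lemma axial_coefE f p (t : star p) : f p t = axial_coef f (val t).
Proof.
case: t => e ep; have E := eqP ep; subst p.
by rewrite /axial_coef /edge_star /= (eq_irrelevance (eqxx _) ep).
Qed.

Lemma sumZE_eq f g : axial_coef f =1 axial_coef g -> f = g.
Proof. by move=> fg; apply/ffunP=> p; apply/ffunP=> t; rewrite !axial_coefE. Qed.

Lemma card_star (p : gkm_vert G) : #|{: star p}| = m.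
Proof. by rewrite card_sig; move: (gkm_valence p); rewrite cardsE. Qed.

Lemma conn_inj e : injective (@conn m r G e).
Proof.
move=> x y xy; apply: val_inj.
by rewrite -(gkm_nablaK x) -(gkm_nablaK y) -[gkm_nabla x]/(conn x) xy.
Qed.

Lemma conn_bij e : bijective (@conn m r G e).
Proof. by apply: inj_card_bij; [exact: conn_inj | rewrite !card_star]. Qed.

Lemma transportE e (x : ZE (gkm_ini e)) t : transport x (conn t) = x t.
Proof.
rewrite /transport sum_ffunE (bigD1 t) //= big1 => [|t' t't].
  by rewrite addr0 ffunMzE ffunE eqxx intz.
rewrite ffunMzE ffunE (inj_eq (@conn_inj e)) eq_sym (negbTE t't).
exact: mul0rz.
Qed.

Lemma congr_vecE e t : congr_vec e t = congr_coef t.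
Proof.
rewrite /congr_vec sum_ffunE (bigD1 t) //= big1 => [|t' t't].
  by rewrite addr0 ffunMzE ffunE eqxx intz.
by rewrite ffunMzE ffunE eq_sym (negbTE t't); exact: mul0rz.
Qed.

(* The axial equation at the edge [conn t], multiplied by the nonzero vector
   [gkm_alpha (gkm_rev e)] to eliminate the congruence coefficient. *)
Lemma axialP f : f \in @axial_pred m r G <->
  forall e (t : star (gkm_ini e)),
    gkm_alpha (gkm_rev e) *~ (axial_coef f (val t) - axial_coef f (val (conn t)))
    = (gkm_alpha (val t) - gkm_alpha (val (conn t))) *~ axial_coef f (gkm_rev e).
Proof.
have lhsE e (t : star (gkm_ini e)) :
    (transport (f (gkm_ini e)) - f (gkm_ter e)) (conn t) =
    axial_coef f (val t) - axial_coef f (val (conn t)).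
  by rewrite !ffunE transportE !axial_coefE.
have rhsE e (t : star (gkm_ini e)) : gkm_alpha (gkm_rev e) *~
    ((congr_vec (gkm_rev e) *~ (f (gkm_ter e) (rev_star e)) : ZE (gkm_ter e))
       (conn t)) =
    (gkm_alpha (val t) - gkm_alpha (val (conn t))) *~ axial_coef f (gkm_rev e).
  rewrite ffunMzE congr_vecE axial_coefE -mulrzr mulrzA.
  (* The connection along [gkm_rev e] undoes [conn], so this congruence computes [gkm_alpha (val t)
     - gkm_alpha (val (conn t))]. *)
  have := congr_coefP (conn t : star (gkm_ini (gkm_rev e))).
  by rewrite intz => <-; rewrite [val (conn (conn t))]gkm_nablaK.
split=> [/forallP fP e t|fP]; first by rewrite -lhsE (eqP (fP e)) rhsE.
(* Every edge at the terminal vertex has the form [conn t], so these coordinates suffice. *)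
apply/forallP=> e; apply/eqP/ffunP=> y; have [g _ gK] := conn_bij e.
rewrite -(gK y); apply: (mulrIz_row (gkm_alpha_neq0 (gkm_rev e))).
by rewrite lhsE fP rhsE.
Qed.

(** The row [v] encodes a linear functional through the standard pairing. *)
Definition functional_coef (v : 'rV[int]_r) : sumZE G :=
  [ffun p => [ffun t : star p => (v *m (gkm_alpha (val t))^T) 0 0] : ZE p].

Lemma axial_functional_coef v e :
  axial_coef (functional_coef v) e = (v *m (gkm_alpha e)^T) 0 0.
Proof. by rewrite /axial_coef !ffunE. Qed.

(** With c the congruence coefficient of [conn t] along [gkm_rev e], a = [gkm_alpha (gkm_rev e)] and
    l the functional, both sides of [axialP] equal c l(a) a. *)
Lemma functional_coef_axial v : functional_coef v \in @axial_pred m r G.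
Proof.
apply/axialP=> e t; rewrite !axial_functional_coef.
have /eqP := congr_coefP (conn t : star (gkm_ini (gkm_rev e))).
rewrite [val (conn (conn t))]gkm_nablaK subr_eq => /eqP ->.
rewrite addrK -!scaler_int linearD linearZ mulmxDr -scalemxAr !mxE !intz.
by rewrite addrK scalerA mulrC.
Qed.

Definition functional_axial (v : 'rV[int]_r) : axial_group G :=
  AxialGroup (functional_coef_axial v).

Definition axial_eval (k : nat) (E : 'I_k -> gkm_edge G) (f : axial_group G) :
  'rV[int]_k := \row_j axial_coef f (E j).

Lemma axial_eval_is_zmod_morphism k (E : 'I_k -> gkm_edge G) :
  zmod_morphism (axial_eval E).
Proof.
move=> f g; apply/rowP=> j; rewrite !mxE /axial_coef.
by rewrite -[axial_val (f - g)]/(val (f - g)) raddfB !ffunE.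
Qed.

HB.instance Definition _ k (E : 'I_k -> gkm_edge G) :=
  GRing.isZmodMorphism.Build (axial_group G) 'rV[int]_k (axial_eval E)
    (axial_eval_is_zmod_morphism E).

End AxialFunctions.

(** * The Grassmannian graph: scalar equations and their solutions *)

Section GrassmannianAxialFunctions.
Variables (n : nat) (n_gt0 : (0 < n)%N).
Local Notation G := (grassmannian_gkm n_gt0).
Local Notation I := 'I_n.+2.

Lemma exists_third (j k : I) : exists2 i, i != j & i != k.
Proof.
have : (0 < #|~: [set j; k]|)%N.
  rewrite -(ltn_add2l #|[set j; k]|) cardsC card_ord cards2 addn0 !ltnS.
  exact: leq_trans (leq_b1 _) n_gt0.
by case/card_gt0P=> i; rewrite !inE negb_or => /andP[ij ik]; exists i.
Qed.

(* Extended by the junk value 0 to triples that are not pairwise distinct. *)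
Definition gr_coef (f : sumZE G) (i j k : I) : int :=
  oapp (fun e : gr_edge n => axial_coef f (e : gkm_edge G)) 0 (insub (i, j, k)).

Lemma gr_coefE (f : sumZE G) (e : gr_edge n) :
  axial_coef f (e : gkm_edge G) = gr_coef f (val e).1.1 (val e).1.2 (val e).2.
Proof. by rewrite /gr_coef -!surjective_pairing valK. Qed.

Lemma gr_coef_axial (f : axial_group G) (e t : gr_edge n) :
  gr_ini t = gr_ini e ->
  let j := (val e).1.2 in let k := (val e).2 in
  let: (x, y, z) := val t in
  gr_coef f x y z - gr_coef f (tperm j k x) (tperm j k y) (tperm j k z) =
  (((j == z)%:R - (j == y)%:R) -
   ((j == tperm j k z)%:R - (j == tperm j k y)%:R)) *
    gr_coef f (val e).1.1 k j.
Proof.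
move=> ti j k.
have ti' : gr_ini t == gr_ini e by apply/eqP.
pose t_ : star (gkm_ini (e : gkm_edge G)) := exist _ t ti'.
have t'E := val_gr_nabla t_.
have := (axialP f).1 (axial_valP f) e t_.
(* The label of the reversed edge is a_j - a_k, whose lift has entry 1 at [j]; this coordinate makes
   the vector equation scalar. *)
move/(congr1 (fun w => @gr_lift n w j)).
rewrite !gr_liftMz gr_liftD gr_liftN !gr_lift_alpha !gr_coefE.
rewrite [val (val (conn t_))]t'E val_gr_rev.
have [_ _ jk] := gr_edgeP e.
rewrite /= eqxx (negbTE jk) subr0 mul1r.
by case: (sval t) => -[x y] z.
Qed.

(** Transporting the edge along itself has factor -2, as its label changes sign. *)
Lemma gr_coef_antisym (f : axial_group G) i j k :
  i != j -> i != k -> j != k -> gr_coef f i j k = - gr_coef f i k j.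
Proof.
move=> ij ik jk; have ji : j != i by rewrite eq_sym.
have ki : k != i by rewrite eq_sym.
have := gr_coef_axial f (erefl (gr_ini (gr_E ij ik jk))).
rewrite /= tpermD // tpermL tpermR eqxx (negbTE jk).
rewrite sub0r subr0 -opprD mulNr mulrDl mul1r => /eqP.
by rewrite subr_eq opprD subrK => /eqP.
Qed.

(** Transport (j,i,k) along (i,j,k): the factor is -1, and antisymmetry absorbs the sign. *)
Lemma gr_coef_rotate (f : axial_group G) i j k :
  i != j -> i != k -> j != k ->
  gr_coef f i j k = gr_coef f j i k - gr_coef f k i j.
Proof.
move=> ij ik jk; have ji : j != i by rewrite eq_sym.
have ki : k != i by rewrite eq_sym.
have ti : gr_ini (gr_E ji jk ik) = gr_ini (gr_E ij ik jk).
  by apply/gr_iniP; right.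
have := gr_coef_axial f ti.
rewrite /= (tpermD ji ki) tpermL tpermR eqxx (negbTE jk) (negbTE ji).
by rewrite !subr0 sub0r mulN1r -(gr_coef_antisym f ij) // => ->.
Qed.

(** Transport (i,j,k) along (j,i,i'): the swap of [i] and [i'] fixes [j] and [k], so the label is
    unchanged and the factor is 0. *)
Lemma gr_coef_indep (f : axial_group G) i i' j k :
  i != j -> i != k -> i' != j -> i' != k -> j != k ->
  gr_coef f i j k = gr_coef f i' j k.
Proof.
have [-> //|ii'] := eqVneq i i'; move=> ij ik i'j i'k jk.
have ji : j != i by rewrite eq_sym.
have ji' : j != i' by rewrite eq_sym.
have ti : gr_ini (gr_E ij ik jk) = gr_ini (gr_E ji ji' ii').
  by apply/gr_iniP; right.
have := gr_coef_axial f ti.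
rewrite /= tpermL (tpermD ij i'j) (tpermD ik i'k).
by rewrite subrr mul0r => /subr0_eq.
Qed.

Lemma gr_coef_potential (f : axial_group G) (u : I -> int) :
  u ord_max = 0 ->
  (forall z, z != ord_max -> exists i,
     [/\ i != ord_max, i != z & u z = gr_coef f i ord_max z]) ->
  forall i j k, i != j -> i != k -> j != k -> gr_coef f i j k = u k - u j.
Proof.
move=> u0 uE.
have from_max i k : i != ord_max -> i != k -> k != ord_max ->
    gr_coef f i ord_max k = u k.
  move=> im ik km; have [i' [i'm i'k ->]] := uE k km.
  by apply: gr_coef_indep; rewrite // eq_sym.
move=> i j k ij ik jk.
have [jm|jm] := eqVneq j ord_max.
  by rewrite jm u0 subr0 from_max // -jm // eq_sym.
have [km|km] := eqVneq k ord_max.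
  by rewrite gr_coef_antisym // km u0 sub0r from_max // -km.
have mj : ord_max != j by rewrite eq_sym.
have mk : ord_max != k by rewrite eq_sym.
(* When neither [j] nor [k] is [ord_max], the common index is moved to [ord_max]; rotation then
   leaves two values based at [ord_max]. *)
rewrite (@gr_coef_indep f i ord_max) // gr_coef_rotate // !from_max //.
by rewrite eq_sym.
Qed.

Lemma gr_a_max : gr_a (ord_max : I) = 0.
Proof. by apply/rowP=> j; rewrite !mxE /= gtn_eqF. Qed.

Lemma gr_a_lift (j : 'I_n.+1) : gr_a (lift ord_max j) = delta_mx 0 j.
Proof.
apply/rowP=> i; rewrite !mxE /= /bump leqNgt ltn_ord add0n.
by rewrite eq_sym val_eqE.
Qed.

(** Since a_(n+2) = 0, these edges are labelled by the standard basis, so evaluating there reads off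
    the coordinates of a functional. *)
Lemma gr_max_edges : exists E : 'I_n.+1 -> gr_edge n,
  forall z, (val (E z)).1.2 = ord_max /\ (val (E z)).2 = lift ord_max z.
Proof.
apply: (@fin_all_exists _ (fun=> gr_edge n) (fun z e =>
  (val e).1.2 = ord_max /\ (val e).2 = lift ord_max z)) => z.
have [i im iz] := exists_third ord_max (lift ord_max z).
by exists (gr_E im iz (neq_lift _ _)).
Qed.

Lemma axial_eval_functional (E : 'I_n.+1 -> gr_edge n) :
  (forall z, (val (E z)).1.2 = ord_max /\ (val (E z)).2 = lift ord_max z) ->
  cancel (@functional_axial _ _ G) (@axial_eval _ _ G _ E).
Proof.
move=> EP v; apply/rowP=> z; have [Ej Ek] := EP z.
rewrite mxE axial_functional_coef [gkm_alpha _]/(gr_alpha (E z)) /gr_alpha.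
by rewrite Ej Ek gr_a_max oppr0 add0r gr_a_lift trmx_delta -colE mxE.
Qed.

Lemma functional_axial_eval (E : 'I_n.+1 -> gr_edge n) :
  (forall z, (val (E z)).1.2 = ord_max /\ (val (E z)).2 = lift ord_max z) ->
  cancel (@axial_eval _ _ G _ E) (@functional_axial _ _ G).
Proof.
move=> EP f; apply/val_inj/sumZE_eq=> e; set v := axial_eval _ f.
rewrite axial_functional_coef [gkm_alpha _]/(gr_alpha e) [RHS]gr_coefE.
(* The potential is the functional [v] applied to a_z, which on the edge [E z'] reproduces the
   coefficient of [f]. *)
pose u z : int := (v *m (gr_a z)^T) 0 0.
have [ij ik jk] := gr_edgeP e.
have u0 : u ord_max = 0 by rewrite /u gr_a_max trmx0 mulmx0 mxE.
rewrite (@gr_coef_potential f u u0) // => [|z].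
  by rewrite /gr_alpha linearD linearN mulmxDr mulmxN [LHS]mxE [X in X + _]mxE addrC.
case: (unliftP ord_max z) => [z' -> _|->]; last by rewrite eqxx.
have [Ej Ek] := EP z'; have [] := gr_edgeP (E z'); rewrite Ej Ek => im iz _.
exists (val (E z')).1.1; split=> //.
by rewrite /u gr_a_lift trmx_delta -colE [LHS]mxE [LHS]mxE gr_coefE Ej Ek.
Qed.

End GrassmannianAxialFunctions.

Theorem theorem5p4 (n : nat) (n_ge1 : (1 <= n)%N) :
  exists phi : {additive axial_group (grassmannian_gkm n_ge1) -> 'rV[int]_n.+1},
    bijective phi.
Proof.
have [E EP] := gr_max_edges n_ge1.
exists (@axial_eval _ _ (grassmannian_gkm n_ge1) _ E).
exists (@functional_axial _ _ (grassmannian_gkm n_ge1)).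
  exact: functional_axial_eval.
exact: axial_eval_functional.
Qed.
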